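(* Let $\alpha\in\mathbb{C}$ with $|\alpha|>1$, and let $n$ be an integer with $n\ge N_2(\alpha)$, where $$N_2(\alpha)=\frac{20\log(|\alpha|+1)-4\log(\log|\alpha|)}{\log|\alpha|}.$$ Then $$\lambda_{\alpha,n,1}=g_-(\vartheta_{\alpha,n,1}),\qquad \lambda_{\alpha,n,n}=g_+(\vartheta_{\alpha,n,n}),$$ where $\vartheta_{\alpha,n,1}$ is the unique positive solution of the equation $$x=\operatorname{arctanh}\frac{2(|\alpha|^2-1)\tanh\frac{nx}{2}}{|\alpha+1|^2\tanh^2\frac{nx}{2}+|\alpha-1|^2},$$ and $\vartheta_{\alpha,n,n}$ is the unique positive solution of the equation $$x=\operatorname{arctanh}\frac{2(|\alpha|^2-1)\tanh\frac{nx}{2}}{|\alpha+(-1)^n|^2\tanh^2\frac{nx}{2}+|\alpha-(-1)^n|^2}.$$ For $2\le j\le n-1$, one has $\lambda_{\alpha,n,j}=g(\vartheta_{\alpha,n,j})$, where the number $\vartheta_{\alpha,n,j}=g^{-1}(\lambda_{\alpha,n,j})$ satisfies $$\vartheta_{\alpha,n,j}=\frac{j\pi+\eta_{\alpha,j}(\vartheta_{\alpha,n,j})}{n}.$$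
   Context: For $\alpha\in\mathbb{C}$ and an integer $n\ge 3$, $A_{\alpha,n}$ is the $n\times n$ complex matrix with all main diagonal entries equal to $2$, all entries on the first subdiagonal and on the first superdiagonal equal to $-1$, the $(1,n)$ entry equal to $-\overline{\alpha}$, the $(n,1)$ entry equal to $-\alpha$, and all other entries $0$. It is Hermitian, and its (real) eigenvalues, counted with multiplicity, are enumerated in ascending order: $\lambda_{\alpha,n,1}\le\cdots\le\lambda_{\alpha,n,n}$. Throughout $n\ge3$, and $\log$ is the natural logarithm. The function $g(x)=4\sin^2(x/2)$ is a strictly increasing bijection $[0,\pi]\to[0,4]$, and $g^{-1}\colon[0,4]\to[0,\pi]$ is its inverse; for $2\le j\le n-1$ and $\alpha,n$ as in the claim, $\lambda_{\alpha,n,j}\in(0,4)$. For $x>0$, $g_-(x)=-4\sinh^2(x/2)$ and $g_+(x)=4+4\sinh^2(x/2)$. Here $\operatorname{arctanh}\colon(-1,1)\to\mathbb{R}$ is the real inverse hyperbolic tangent; a solution of an equation involving it must have the argument of $\operatorname{arctanh}$ in $(-1,1)$. For $\alpha\in\mathbb{C}\setminus\{-1,1\}$ put $k_\alpha=\frac{1-|\alpha|^2}{|1+\alpha|^2}$, $l_\alpha=\frac{|1-\alpha|}{|1+\alpha|}$, and for every integer $j$ define $\eta_{\alpha,j}\colon[0,\pi]\to\mathbb{R}$ by $$\eta_{\alpha,j}(x)=-2\arctan\left(\left((-1)^{j+1}k_\alpha\cot(x)+\sqrt{k_\alpha^2\cot^2(x)+l_\alpha^2}\right)^{(-1)^j}\right)$$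 for $x\in(0,\pi)$, with the values at $x=0$ and $x=\pi$ understood as one-sided limits. *)

(* Defs.v *)
From HB Require Import structures.
From mathcomp Require Import all_boot all_order all_algebra.
From mathcomp Require Import complex.
From mathcomp Require Import all_classical all_reals all_analysis.

Set Implicit Arguments.
Unset Strict Implicit.
Unset Printing Implicit Defensive.

Import Order.TTheory GRing.Theory Num.Theory.
Import numFieldNormedType.Exports.

Local Open Scope classical_set_scope.
Local Open Scope ring_scope.
Local Open Scope complex_scope.

Notation cabs := ComplexField.Normc.normc.

Section Definitions.
Context {R : realType}.
Implicit Types (alpha : R[i]) (n : nat) (x : R).

(* Indices are shifted by one: rows and columns are numbered 0, ..., n - 1. *)
Definition laplacian_mx alpha n : 'M[R[i]]_n :=
  \matrix_(i, j)
    if i == j then 2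
    else if (i == j.+1 :> nat) || (j == i.+1 :> nat) then -1
    else if (i == 0%N :> nat) && (j == n.-1 :> nat) then - alpha^*
    else if (i == n.-1 :> nat) && (j == 0%N :> nat) then - alpha
    else 0.

(* The roots of the characteristic polynomial, with multiplicity, in ascending
   order. [Re] only serves to land in R: it is meant for Hermitian matrices,
   whose eigenvalues are real, see [char_poly_eigenvalues]. *)
Definition eigenvalues n (A : 'M[R[i]]_n) : seq R :=
  sort <=%R [seq complex.Re z | z <- sval (closed_field_poly_normal (char_poly A))].

(* lambda_{alpha,n,j} for 1 <= j <= n. *)
Definition lambda alpha n (j : nat) : R :=
  (eigenvalues (laplacian_mx alpha n))`_j.-1.

Definition sinh x : R := (expR x - expR (- x)) / 2.
Definition cosh x : R := (expR x + expR (- x)) / 2.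
Definition tanh x : R := sinh x / cosh x.
(* Only meaningful on ]-1, 1[. *)
Definition arctanh x : R := ln ((1 + x) / (1 - x)) / 2.
Definition cot x : R := cos x / sin x.

Definition g x : R := 4 * sin (x / 2) ^+ 2.
Definition g_inv : R -> R := pinv `[0, pi] g.
Definition g_minus x : R := - (4 * sinh (x / 2) ^+ 2).
Definition g_plus x : R := 4 + 4 * sinh (x / 2) ^+ 2.

Definition kcoef alpha : R := (1 - cabs alpha ^+ 2) / cabs (1 + alpha) ^+ 2.
Definition lcoef alpha : R := cabs (1 - alpha) / cabs (1 + alpha).

(* The inner power is an integer power: the exponent is 1 or -1. *)
Definition eta_interior alpha (j : int) x : R :=
  - (2 * atan (((-1) ^ (j + 1) * kcoef alpha * cot x
                + Num.sqrt (kcoef alpha ^+ 2 * cot x ^+ 2 + lcoef alpha ^+ 2))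
               ^ ((-1 : int) ^ j))).

Definition eta_fun alpha (j : int) x : R :=
  if x == 0 then lim (eta_interior alpha j y @[y --> 0^'+])
  else if x == pi then lim (eta_interior alpha j y @[y --> pi^'-])
  else eta_interior alpha j x.

Definition N2 alpha : R :=
  (20 * ln (cabs alpha + 1) - 4 * ln (ln (cabs alpha))) / ln (cabs alpha).

Definition edge_arg alpha n (s : R[i]) x : R :=
  (2 * (cabs alpha ^+ 2 - 1) * tanh (n%:R * x / 2))
  / (cabs (alpha + s) ^+ 2 * tanh (n%:R * x / 2) ^+ 2 + cabs (alpha - s) ^+ 2).

(* x is a positive solution of x = arctanh (edge_arg alpha n s x); the argument
   of arctanh is required to lie in its domain. *)
Definition edge_sol alpha n (s : R[i]) x : Prop :=
  [/\ 0 < x, -1 < edge_arg alpha n s x < 1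
    & x = arctanh (edge_arg alpha n s x)].

Lemma sorted_eigenvalues n (A : 'M[R[i]]_n) : sorted <=%R (eigenvalues A).
Proof. exact/sort_sorted/le_total. Qed.

Lemma laplacian_mx_herm alpha n : (3 <= n)%N ->
  laplacian_mx alpha n \is hermsymmx.
Proof.
move=> n3; apply/is_hermitianmxP; rewrite expr0 scale1r.
apply/matrixP => i j; rewrite !mxE (eq_sym j i).
rewrite (orbC (j == i.+1 :> nat)).
have conjE (z : R[i]) : Num.conj z = z^*%C by [].
case: ifP => _; first by rewrite conjC_nat.
case: ifP => _; first by rewrite rmorphN rmorph1.
have ne : (0 == n.-1)%N = false by case: n n3 {i j} => [|[]].
case: (i =P 0%N :> nat) => [i0|i0]; case: (j =P 0%N :> nat) => [j0|j0] /=;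
  rewrite ?i0 ?j0 ?ne ?andbF ?andbT /= ?rmorph0 //.
- by case: ifP => _; rewrite ?rmorph0 // rmorphN.
- by case: ifP => _; rewrite ?rmorph0 // rmorphN /= conjE conjcK.
Qed.

Lemma char_poly_eigenvalues n (A : 'M[R[i]]_n) : A \is hermsymmx ->
  char_poly A = \prod_(x <- eigenvalues A) ('X - (x%:C)%:P).
Proof.
move=> Aherm.
have := hermitian_spectral_diag_real Aherm.
have := spectral_unit A.
have /hermitian_normalmx/orthomx_spectralP := Aherm.
move: (spectralmx A) (spectral_diag A) => P D Aspec Pu Dreal.
rewrite /eigenvalues.
case: closed_field_poly_normal => /= r.
rewrite (monicP (char_poly_monic A)) scale1r => rE.
have real_r z : z \in r -> (complex.Re z)%:C = z.
  rewrite -root_prod_XsubC -rE -eigenvalue_root_char => /eigenvalueP[v vA v0].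
  apply: RRe_real.
  pose w := v *m invmx P.
  have wD : w *m diag_mx D = z *: w.
    rewrite /w scalemxAl -vA Aspec !mulmxA -[RHS]mulmxA mulmxV //.
    by rewrite mulmx1.
  have : w != 0.
    by apply: contra_neq v0 => w0; rewrite -(mulmxKV Pu v) -/w w0 mul0mx.
  clearbody w => /rV0Pn[i wi].
  have /rowP/(_ i) := wD; rewrite mul_mx_diag !mxE mulrC => wE; rewrite -(mulIf wi wE).
  by have /mxOverP/(_ 0 i) := Dreal.
rewrite (perm_big _ (permEl (perm_sort _ _))) big_map rE.
by apply: eq_big_seq => z /real_r ->.
Qed.

End Definitions.

(* Main.v *)
Require Import Defs.
From HB Require Import structures.
From mathcomp Require Import all_boot all_order all_algebra.
From mathcomp Require Import complex.
From mathcomp Require Import all_classical all_reals all_analysis.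
From mathcomp Require polyrcf.
From mathcomp Require Import ring lra zify.

Set Implicit Arguments.
Unset Strict Implicit.
Unset Printing Implicit Defensive.

Import Order.TTheory GRing.Theory Num.Theory.
Import numFieldNormedType.Exports.

Local Open Scope ring_scope.

(** Put lambda = 2 - c.  The rows of the eigenvector equation say that the
    entries of the vector satisfy v_{k+1} = c v_k - v_{k-1}, so they are
    combinations of the Chebyshev values u_k(c), with u_0 = 0 and u_1 = 1; the
    two corner entries of the matrix turn the first and the last row into
    boundary conditions, which are compatible as soon as
      Q(lambda) = u_{n+1}(c) - |alpha|^2 u_{n-1}(c) - 2 Re alpha
    vanishes ([secular], [secular_eigenvalue]).  Hence every real zero of Q is
    an eigenvalue, and no determinant has to be expanded.

    Zeros are found by the intermediate value theorem.  At the nodes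
    g(j pi / n), for 0 < j < n, the value of Q is
    (-1)^j (1 + |alpha|^2) - 2 Re alpha, which alternates in sign because
    |alpha| is not 1; this gives one zero between any two consecutive nodes.
    For n (|alpha| - 1) > |alpha| + 1 the values at 0 and 4 have the sign
    opposite to the one near -oo and +oo respectively, so there is also a
    negative zero and a zero above 4.  The assumption on n implies that
    inequality ([N2_bound]).  Altogether these are n distinct eigenvalues, hence
    all of them, already in ascending order ([lambda_location]).

    It remains to parametrize.  Under lambda = 2 - 2 cos x the equation
    Q(lambda) = 0 is quadratic in tan(nx/2), and the sign of this tangent, known
    from the position of x between two nodes, selects the root that defines eta
    ([secular_eta]).  Under lambda = 2 - 2 cosh x, or 2 + 2 cosh x, it is the
    equation with arctanh ([edge_solP]); its positive solution is unique because
    exactly one eigenvalue is negative and exactly one exceeds 4. *)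

(** * Chebyshev recurrence *)

(** This is U_{k-1}(c/2), for U the Chebyshev polynomials of the second kind.
    The ring is arbitrary so that the same function gives polynomials, real
    values and complex values. *)
Fixpoint cheb {A : comNzRingType} (c : A) (k : nat) : A :=
  if k is k1.+1 then
    if k1 is k2.+1 then c * cheb c k1 - cheb c k2 else 1
  else 0.

Lemma chebSS (A : comNzRingType) (c : A) k :
  cheb c k.+2 = c * cheb c k.+1 - cheb c k.
Proof. by []. Qed.

(** The Casoratian of a recurrence with constant term -1 is constant. *)
Lemma cheb_cassini (A : comNzRingType) (c : A) k :
  cheb c k.+1 ^+ 2 - cheb c k * cheb c k.+2 = 1.
Proof.
elim: k => [|k IH]; first by rewrite /=; ring.
by rewrite -IH !chebSS; ring.
Qed.

Lemma rmorph_cheb (A B : comNzRingType) (f : {rmorphism A -> B}) (c : A) k :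
  f (cheb c k) = cheb (f c) k.
Proof.
suff: f (cheb c k) = cheb (f c) k /\ f (cheb c k.+1) = cheb (f c) k.+1 by case.
elim: k => [|k [IH1 IH2]]; first by rewrite /= rmorph0 rmorph1.
by split=> //; rewrite !chebSS rmorphB rmorphM IH1 IH2.
Qed.

(** A solution of the recurrence that vanishes at 0 is determined by its value
    at 1; the closed forms below are all obtained in this way. *)
Lemma cheb_recurrence (A : comNzRingType) (c s : A) (h : nat -> A) :
  h 0%N = 0 -> h 1%N = s -> (forall k, h k.+2 = c * h k.+1 - h k) ->
  forall k, h k = s * cheb c k.
Proof.
move=> h0 h1 hS k.
suff: h k = s * cheb c k /\ h k.+1 = s * cheb c k.+1 by case.
elim: k => [|k [IH1 IH2]]; first by rewrite /= mulr0 mulr1.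
by split=> //; rewrite hS chebSS IH1 IH2; ring.
Qed.

Lemma cheb_opp (A : comNzRingType) (c : A) k :
  cheb (- c) k = (-1) ^+ k.+1 * cheb c k.
Proof.
suff E : - (-1) ^+ k * cheb (- c) k = 1 * cheb c k.
  by rewrite -[cheb c k]mul1r -E exprS !mulrA -(signr_odd _ k); case: odd; ring.
apply: (@cheb_recurrence _ c 1 (fun i => - (-1) ^+ i * cheb (- c) i)) => [||i].
- by rewrite /= mulr0.
- by rewrite /= expr1; ring.
- by rewrite chebSS !exprS; ring.
Qed.

Lemma cheb_2 (A : comNzRingType) k : cheb (2 : A) k = k%:R.
Proof.
rewrite -[LHS]mul1r -(@cheb_recurrence _ _ _ (fun i => i%:R)) // => i.
by rewrite -!natr1; ring.
Qed.

(** * Eigenvectors from the secular equation *)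

Section Eigenvector.
Context {R : realType}.
Implicit Types (alpha : R[i]) (n : nat).

Lemma sum_pick n (w : nat -> R[i]) (k : nat) (z : R[i]) :
  \sum_(i < n) w i * (z *+ (i == k :> nat))
  = (if (k < n)%N then z * w k else 0).
Proof.
case: ifP => [kn|/negbT kn].
  rewrite (bigD1 (Ordinal kn)) //= eqxx big1 ?addr0 1?mulrC // => i.
  by rewrite -val_eqE /= => /negPf ->; rewrite mulr0n mulr0.
rewrite big1 // => i _; case: eqP => [ik|]; last by rewrite mulr0n mulr0.
by rewrite -ik ltn_ord in kn.
Qed.

(** A sum of delta functions of the row index: the form in which a product with
    a row vector can be summed by [sum_pick].  The order 3 keeps the corners away
    from the two side diagonals. *)
Lemma laplacian_mxE alpha n (i j : 'I_n) : (3 <= n)%N ->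
  laplacian_mx alpha n i j =
  2 *+ (i == j :> nat) + (-1) *+ (i == j.+1 :> nat) +
  (if (0 < j)%N then (-1) *+ (i == j.-1 :> nat) else 0)
  + (if (j == n.-1 :> nat) then (- alpha^*%C) *+ (i == 0%N :> nat) else 0)
  + (if (j == 0%N :> nat) then (- alpha) *+ (i == n.-1 :> nat) else 0).
Proof.
move=> n_ge3; rewrite mxE -val_eqE /=.
have := ltn_ord i; have := ltn_ord j.
case: (ltnP 0 j) => j0; case: (eqVneq (i : nat) j) => ij;
case: (eqVneq (i : nat) j.+1) => ij1; case: (eqVneq (j : nat) i.+1) => ji1;
case: (eqVneq (i : nat) j.-1) => ji2; try (exfalso; lia);
case: (eqVneq (i : nat) 0%N) => i0; case: (eqVneq (j : nat) n.-1) => jn;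
try (exfalso; lia);
case: (eqVneq (j : nat) 0%N) => j00; case: (eqVneq (i : nat) n.-1) => iN;
try (exfalso; lia); rewrite /= => *;
rewrite ?mulr0n ?mulr1n ?addr0 ?add0r //.
Qed.

Lemma mul_laplacian_mx alpha n (w : nat -> R[i]) (j : 'I_n) : (3 <= n)%N ->
  ((\row_(i < n) w i) *m laplacian_mx alpha n) 0 j
  = 2 * w j - (if (j.+1 < n)%N then w j.+1 else alpha^*%C * w 0%N)
    - (if (0 < j)%N then w j.-1 else alpha * w n.-1).
Proof.
move=> n_ge3; have jn := ltn_ord j.
have n0 : (0 < n)%N by lia.
have n1 : (n.-1 < n)%N by lia.
have j1 : (j.-1 < n)%N by lia.
rewrite mxE; under eq_bigr do
  rewrite mxE laplacian_mxE // !mulrDr !(fun_if (fun z => w _ * z)) mulr0.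
rewrite !big_split /= !sum_pick jn.
case: ifP => j0; case: (eqVneq (j : nat) n.-1) => jn1;
  case: (eqVneq (j : nat) 0%N) => j00; case: ifP => jn2; try (exfalso; lia);
  rewrite ?sum_pick ?big1_eq //;
  rewrite ?n1 ?j1 ?n0; ring.
Qed.

(** Up to sign, the characteristic polynomial of the matrix at 2 - c. *)
Definition secular alpha n (c : R) : R :=
  cheb c n.+1 - cabs alpha ^+ 2 * cheb c n.-1 - 2 * complex.Re alpha.

Lemma cabs_sqrE (z : R[i]) : (cabs z ^+ 2)%:C%C = z * (z^*)%C.
Proof.
case: z => a b /=; rewrite sqr_sqrtr ?addr_ge0 ?sqr_ge0 //.
by apply/eqP; rewrite eq_complex /=; apply/andP; split; apply/eqP; ring.
Qed.

(** A vector that continues to the indices -1 and n by the recurrence solves the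
    eigenvector equation when it satisfies the two boundary conditions
    w_{-1} = alpha w_{n-1} and w_n = alpha^* w_0.  In the unknowns A = w_0 and
    B = w_{-1} they form a linear system whose determinant is, up to sign,
    [secular], by [cheb_cassini]. *)
Lemma secular_eigenvalue alpha n (c : R) : (3 <= n)%N ->
  secular alpha n c = 0 ->
  eigenvalue (laplacian_mx alpha n) ((2 - c)%:C)%C.
Proof.
move=> n_ge3 c0; pose C := (c%:C)%C : R[i].
pose u := cheb C.
have uE k : u k = ((cheb c k)%:C)%C by rewrite /u /C -rmorph_cheb.
have Cassini : u n ^+ 2 - u n.-1 * u n.+1 = 1.
  by case: (n) n_ge3 => // m _; exact: cheb_cassini.
have uSS k : u k.+2 = C * u k.+1 - u k by [].
have [u0 u1] : u 0%N = 0 /\ u 1%N = 1 by [].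
have secC : u n.+1 - alpha * alpha^*%C * u n.-1 = alpha + alpha^*%C.
  rewrite -cabs_sqrE !uE -rmorphM -rmorphB /=.
  have -> : cheb c n.+1 - cabs alpha ^+ 2 * cheb c n.-1 = 2 * complex.Re alpha.
    by move/eqP: c0; rewrite subr_eq0 => /eqP.
  case: (alpha) => a b.
  by apply/eqP; rewrite eq_complex /=; apply/andP; split; apply/eqP; ring.
clearbody u.
have [[A B]] : exists AB : R[i] * R[i],
    [/\ AB != 0, alpha * (AB.1 * u n - AB.2 * u n.-1) = AB.2
      & AB.1 * u n.+1 - AB.2 * u n = alpha^*%C * AB.1].
  have det : (1 + alpha * u n.-1) * (u n.+1 - alpha^*%C) = alpha * u n ^+ 2.
    have -> : u n ^+ 2 = 1 + u n.-1 * u n.+1 by rewrite -Cassini; ring.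
    have -> : u n.+1 = alpha + alpha^*%C + alpha * alpha^*%C * u n.-1.
      by rewrite -secC; ring.
    ring.
  (* The second equation gives the solution (u_n, u_{n+1} - alpha^* ) unless u_n
     vanishes; then the determinant factors and one unknown can be taken 0. *)
  have [un0|un0] := eqVneq (u n) 0.
    move: det; rewrite un0 expr0n /= mulr0 => /eqP; rewrite mulf_eq0.
    case/orP => /eqP E.
      exists (0, 1) => /=; split; rewrite ?un0 ?mulr0 ?mul0r ?sub0r ?subr0 ?oppr0 //.
        by rewrite xpair_eqE oner_eq0 andbF.
      have -> : alpha * - (1 * u n.-1) = - (1 + alpha * u n.-1) + 1 by ring.
      by rewrite E oppr0 add0r.
    exists (1, 0) => /=; split; rewrite ?un0 ?mulr0 ?mul0r ?sub0r ?subr0 ?oppr0 //.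
      by rewrite xpair_eqE oner_eq0.
      by rewrite mulr0.
    by move/eqP: E; rewrite subr_eq0 => /eqP ->; ring.
  exists (u n, u n.+1 - alpha^*%C) => /=; split; last by ring.
    by rewrite xpair_eqE (negPf un0).
  have -> : alpha * (u n * u n - (u n.+1 - alpha^*%C) * u n.-1)
    = alpha * u n ^+ 2 - alpha * u n.-1 * (u n.+1 - alpha^*%C) by ring.
  by rewrite -det; ring.
rewrite /= => -[AB0 EB EA].
pose w k := A * u k.+1 - B * u k.
have wS k : w k.+2 = C * w k.+1 - w k by rewrite /w !uSS; ring.
have w0 : w 0%N = A by rewrite /w u0 u1 mulr1 mulr0 subr0.
have w1 : w 1%N = C * A - B by rewrite /w uSS u0 u1; ring.
have wn1 : alpha * w n.-1 = B by rewrite /w prednK // (leq_trans _ n_ge3).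
have wn : w n = alpha^*%C * A by [].
have rcC : ((2 - c)%:C)%C = 2 - C :> R[i].
  by rewrite rmorphB /= rmorph_nat.
apply/eigenvalueP; exists (\row_(i < n) w i).
  apply/rowP => j; rewrite mul_laplacian_mx // !mxE rcC w0 wn1 -wn.
  have -> : (if (j.+1 < n)%N then w j.+1 else w n) = w j.+1.
    by case: ltnP => // ?; congr w; have := ltn_ord j; lia.
  case: j => -[|k] kn /=; first by rewrite w0 w1; ring.
  by rewrite wS; ring.
apply: contra_neq AB0 => /rowP w00.
have A0 : A = 0.
  have lt : (0 < n)%N by lia.
  by have := w00 (Ordinal lt); rewrite !mxE w0.
have wn10 : w n.-1 = 0.
  have lt : (n.-1 < n)%N by lia.
  by have := w00 (Ordinal lt); rewrite !mxE.
by rewrite A0 -wn1 wn10 mulr0.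
Qed.

End Eigenvector.

(** * Zeros of the secular function as the spectrum *)

Section Spectrum.
Context {R : realType}.
Implicit Types (alpha : R[i]) (mu : nat -> R).

Lemma size_eigenvalues n (A : 'M[R[i]]_n) : A \is hermsymmx ->
  size (eigenvalues A) = n.
Proof.
move=> /char_poly_eigenvalues cpE.
apply: succn_inj.
by rewrite -(size_prod_XsubC _ (fun x => (x%:C)%C)) -cpE size_char_poly.
Qed.

Lemma secular_root_eigenvalues alpha n (x : R) : (3 <= n)%N ->
  secular alpha n (2 - x) = 0 -> x \in eigenvalues (laplacian_mx alpha n).
Proof.
move=> n3 /(secular_eigenvalue n3).
rewrite subKr eigenvalue_root_char.
rewrite (char_poly_eigenvalues (laplacian_mx_herm alpha n3)).
rewrite -(big_map (fun x => (x%:C)%C) xpredT (fun z => 'X - z%:P)).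
rewrite root_prod_XsubC.
by case/mapP => y yA /complexI ->.
Qed.

(** As many distinct eigenvalues as the order of the matrix exhaust the spectrum
    and are simple, so an increasing list of them is the sorted spectrum. *)
Lemma lambda_eq_roots alpha n mu : (3 <= n)%N ->
  (forall j, (j < n)%N -> secular alpha n (2 - mu j) = 0) ->
  (forall j, (j.+1 < n)%N -> mu j < mu j.+1) ->
  forall j, (j < n)%N -> lambda alpha n j.+1 = mu j.
Proof.
move=> n3 mu0 mu_lt j jn; rewrite /lambda /=.
set A := laplacian_mx alpha n.
have szE : size (eigenvalues A) = n.
  by rewrite size_eigenvalues // laplacian_mx_herm.
have mu_sorted : sorted <%R (mkseq mu n).
  apply/(sortedP 0) => i; rewrite size_mkseq => i_n.
  by rewrite !nth_mkseq ?mu_lt // ltnW.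
have sub : {subset mkseq mu n <= eigenvalues A}.
  move=> y /mapP[k]; rewrite mem_iota add0n => /= k_n -> {y}.
  exact/secular_root_eigenvalues/mu0.
have mu_uniq := lt_sorted_uniq mu_sorted.
have sz_le : (size (eigenvalues A) <= size (mkseq mu n))%N.
  by rewrite szE size_mkseq.
have [_ eqi] := uniq_min_size mu_uniq sub sz_le.
rewrite -(@nth_mkseq _ 0 mu n j jn); congr nth.
apply: (sorted_eq le_trans le_anti (sorted_eigenvalues A)).
  exact: sub_sorted (@ltW _ _) _ mu_sorted.
rewrite perm_sym uniq_perm //.
by rewrite (uniq_size_uniq mu_uniq eqi) size_mkseq szE.
Qed.

Lemma secular_root_between alpha n (a b : R) : a <= b ->
  secular alpha n (2 - a) * secular alpha n (2 - b) < 0 ->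
  exists2 x, a < x < b & secular alpha n (2 - x) = 0.
Proof.
pose u := cheb (2%:P - 'X : {poly R}).
pose p := u n.+1 - (cabs alpha ^+ 2)%:P * u n.-1 - (2 * complex.Re alpha)%:P.
have pE x : p.[x] = secular alpha n (2 - x).
  rewrite /p !hornerE.
  have uE k : (u k).[x] = cheb (2 - x) k.
    by rewrite -[LHS]/(horner_eval x (u k)) rmorph_cheb /= /horner_eval !hornerE.
  by rewrite !uE.
move=> ab; rewrite -!pE => /(polyrcf.poly_ivtoo ab)[x xab /rootP px].
by exists x; rewrite -?pE // -[_ && _]/(x \in Interval (BRight a) (BLeft b)).
Qed.

Lemma secular_root_lambda alpha n (x : R) : (3 <= n)%N ->
  secular alpha n (2 - x) = 0 -> exists2 k, (k < n)%N & x = lambda alpha n k.+1.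
Proof.
move=> n3 /(secular_root_eigenvalues n3) xA.
exists (index x (eigenvalues (laplacian_mx alpha n))).
  rewrite -[X in (_ < X)%N](size_eigenvalues (laplacian_mx_herm alpha n3)).
  by rewrite index_mem.
by rewrite /lambda /= nth_index.
Qed.

End Spectrum.

(** * Hyperbolic functions *)

Section Hyperbolic.
Context {R : realType}.
Implicit Types (x y : R).

Lemma cosh2sinh2 (x : R) : cosh x ^+ 2 - sinh x ^+ 2 = 1.
Proof.
rewrite /cosh /sinh expRN; have : expR x != 0 by rewrite expR_eq0.
by move: (expR x) => e e0; field.
Qed.

Lemma sinhD (x y : R) : sinh (x + y) = sinh x * cosh y + cosh x * sinh y.
Proof. by rewrite /sinh /cosh opprD !expRD; field. Qed.

Lemma coshD (x y : R) : cosh (x + y) = cosh x * cosh y + sinh x * sinh y.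
Proof. by rewrite /sinh /cosh opprD !expRD; field. Qed.

Lemma sinh0 : sinh (0 : R) = 0.
Proof. by rewrite /sinh oppr0 subrr mul0r. Qed.

Lemma cosh_gt0 (x : R) : 0 < cosh x.
Proof. by rewrite divr_gt0 // addr_gt0 // expR_gt0. Qed.

Lemma sinhN (x : R) : sinh (- x) = - sinh x.
Proof. by rewrite /sinh opprK; ring. Qed.

Lemma coshN (x : R) : cosh (- x) = cosh x.
Proof. by rewrite /cosh opprK; ring. Qed.

Lemma ltr_sinh (x y : R) : (sinh x < sinh y) = (x < y).
Proof.
have sinh_mono : {homo @sinh R : a b / a < b}.
  move=> a b ab; have e1 : expR a < expR b by rewrite ltr_expR.
  have e2 : expR (- b) < expR (- a) by rewrite ltr_expR ltrN2.
  by rewrite /sinh; lra.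
by rewrite (leW_mono (le_mono sinh_mono)).
Qed.

Lemma sinh_gt0 (x : R) : (0 < sinh x) = (0 < x).
Proof. by rewrite -[X in X < _]sinh0 ltr_sinh. Qed.

(** The witness ln (w + sqrt (w^2 + 1)) is the usual formula for arsinh. *)
Lemma sinh_surj (w : R) : exists x, sinh x = w.
Proof.
set s := Num.sqrt (w ^+ 2 + 1).
have s2 : s ^+ 2 = w ^+ 2 + 1 by rewrite sqr_sqrtr // addr_ge0 ?sqr_ge0.
have s0 : 0 <= s by rewrite sqrtr_ge0.
have ws : 0 < s + w by nra.
exists (ln (s + w)).
rewrite /sinh expRN lnK //.
apply: (mulfI (_ : s + w != 0)); first by rewrite gt_eqF.
have -> : (s + w) * (((s + w) - (s + w)^-1) / 2) = ((s + w)^+2 - 1) / 2.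
  by field; rewrite gt_eqF.
by nra.
Qed.

(** [arctanh] is given by a logarithm that is meaningful on ]-1, 1[ only; the
    range condition is automatic for a value of [tanh]. *)
Lemma arctanhP (x y : R) : (-1 < y < 1 /\ x = arctanh y) <-> tanh x = y.
Proof.
have E : tanh x = (expR (x *+ 2) - 1) / (expR (x *+ 2) + 1).
  rewrite /tanh /sinh /cosh expRN mulr2n expRD.
  have := expR_gt0 x; move: (expR x) => e e0.
  by field; rewrite ?gt_eqF //; nra.
split=> [[/andP[y1 y2] xE]|<-].
  have y3 : 0 < (1 + y) / (1 - y) by apply: divr_gt0; lra.
  rewrite E xE /arctanh (_ : _ *+ 2 = ln ((1 + y) / (1 - y))); last first.
    by rewrite mulr2n; lra.
  rewrite lnK //; field; lra.
have e0 := expR_gt0 (x *+ 2).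
rewrite E /arctanh; set e := expR _ in e0 *.
have -> : (1 + (e - 1) / (e + 1)) / (1 - (e - 1) / (e + 1)) = e.
  by field; apply/andP; split; lra.
split; last by rewrite expRK mulr2n; lra.
by rewrite ltr_pdivlMr ?ltr_pdivrMr; lra.
Qed.

Lemma cosh_half x : cosh x = 1 + 2 * sinh (x / 2) ^+ 2.
Proof.
have {1}-> : x = x / 2 + x / 2 by field.
by rewrite coshD; have := cosh2sinh2 (x / 2); lra.
Qed.

Lemma cosh_surj (c : R) : 1 < c -> exists2 x, 0 < x & cosh x = c.
Proof.
move=> c1; have [y yE] := sinh_surj (Num.sqrt ((c - 1) / 2)).
have h0 : 0 < (c - 1) / 2 by lra.
exists (2 * y); first by rewrite mulr_gt0 // -sinh_gt0 yE sqrtr_gt0.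
have y2 : 2 * y / 2 = y by field.
by rewrite cosh_half y2 yE sqr_sqrtr ?ltW //; field.
Qed.

Lemma cosh_gt1 (x : R) : 0 < x -> 1 < cosh x.
Proof.
move=> x0; rewrite cosh_half ltrDl mulr_gt0 // exprn_gt0 // sinh_gt0; lra.
Qed.

Lemma cosh_inj (x y : R) : 0 < x -> 0 < y -> cosh x = cosh y -> x = y.
Proof.
move=> x0 y0 E.
have sx := cosh2sinh2 x; have sy := cosh2sinh2 y.
have : sinh x = sinh y.
  by apply: (pexpIrn (n := 2)); rewrite ?nnegrE ?ltW ?sinh_gt0 //; rewrite E in sx; lra.
by move=> S; case: (ltgtP x y) => //; rewrite -ltr_sinh S ltxx.
Qed.

End Hyperbolic.

(** * The secular function in trigonometric and hyperbolic coordinates *)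

Section Evaluation.
Context {R : realType}.
Implicit Types (alpha : R[i]) (x y : R).
Local Notation re := (@complex.Re R).

Lemma cabs_sqr (z : R[i]) : cabs z ^+ 2 = complex.Re z ^+ 2 + complex.Im z ^+ 2.
Proof. by case: z => p q /=; rewrite sqr_sqrtr // addr_ge0 ?sqr_ge0. Qed.

Lemma cabs_ge0 (z : R[i]) : 0 <= cabs z.
Proof. by case: z => p q /=; rewrite sqrtr_ge0. Qed.

Lemma Re_cabs_bound (z : R[i]) : - cabs z <= re z <= cabs z.
Proof.
rewrite -ler_norml -(@ler_pXn2r _ 2) ?nnegrE ?cabs_ge0 // real_normK ?num_real //.
by rewrite cabs_sqr lerDl sqr_ge0.
Qed.

Lemma Re_sign alpha m : re ((-1) ^+ m * alpha) = (-1) ^+ m * re alpha.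
Proof.
rewrite -signr_odd -[(-1) ^+ m in RHS]signr_odd.
by case: odd; rewrite ?expr1 ?expr0 ?mulN1r ?mul1r //; case: alpha.
Qed.

Lemma cabs_sign alpha m : cabs ((-1) ^+ m * alpha) = cabs alpha.
Proof.
rewrite -signr_odd.
case: odd; rewrite ?expr1 ?expr0 ?mulN1r ?mul1r //.
by case: alpha => p q; rewrite /= !sqrrN.
Qed.

Lemma cabs_add_sign alpha m :
  cabs (alpha + (-1) ^+ m) ^+ 2 = cabs alpha ^+ 2 + 1 + 2 * re ((-1) ^+ m * alpha).
Proof.
rewrite Re_sign !cabs_sqr -signr_odd -[(-1) ^+ m in RHS]signr_odd.
by case: odd; case: alpha => p q /=; ring.
Qed.

Lemma sin_cheb (x : R) k : sin (k%:R * x) = sin x * cheb (2 * cos x) k.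
Proof.
apply: (@cheb_recurrence _ _ _ (fun k => sin (k%:R * x))) => [||{}k];
  rewrite ?mul0r ?sin0 ?mul1r //.
have -> : k.+2%:R * x = k.+1%:R * x + x by rewrite -(natr1 k.+1); ring.
have -> : k%:R * x = k.+1%:R * x - x by rewrite -(natr1 k); ring.
by rewrite sinD sinB; ring.
Qed.

Lemma sinh_cheb (x : R) k : sinh (k%:R * x) = sinh x * cheb (2 * cosh x) k.
Proof.
apply: (@cheb_recurrence _ _ _ (fun k => sinh (k%:R * x))) => [||{}k];
  rewrite ?mul0r ?sinh0 ?mul1r //.
have -> : k.+2%:R * x = k.+1%:R * x + x by rewrite -(natr1 k.+1); ring.
have -> : k%:R * x = k.+1%:R * x - x by rewrite -(natr1 k); ring.
by rewrite !sinhD sinhN coshN; ring.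
Qed.

Lemma gE x : g x = 2 - 2 * cos x.
Proof.
rewrite /g; have -> : cos x = 1 - 2 * sin (x / 2) ^+ 2; last by ring.
have {1}-> : x = (x / 2) *+ 2 by rewrite mulr2n; field.
by rewrite cos_mulr2n cos2sin2; ring.
Qed.

Lemma g_minusE x : g_minus x = 2 - 2 * cosh x.
Proof. by rewrite /g_minus cosh_half; ring. Qed.

Lemma g_plusE x : g_plus x = 2 + 2 * cosh x.
Proof. by rewrite /g_plus cosh_half; ring. Qed.

Lemma secular_cos alpha n x : (0 < n)%N ->
  sin x * secular alpha n (2 * cos x)
  = (1 + cabs alpha ^+ 2) * cos (n%:R * x) * sin x
    - (cabs alpha ^+ 2 - 1) * sin (n%:R * x) * cos x - 2 * re alpha * sin x.
Proof.
case: n => // n _; rewrite /secular -pred_Sn.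
have := sin_cheb x n.+2; have := sin_cheb x n.
move: (cheb _ n) (cheb _ n.+2) => u v Eu Ev.
transitivity (sin x * v - cabs alpha ^+ 2 * (sin x * u) - 2 * re alpha * sin x);
  first by ring.
rewrite -Eu -Ev.
have -> : n.+2%:R * x = n.+1%:R * x + x by rewrite -(natr1 n.+1); ring.
have -> : n%:R * x = n.+1%:R * x - x by rewrite -(natr1 n); ring.
by rewrite sinD sinB; ring.
Qed.

Lemma secular_cosh alpha n x : (0 < n)%N ->
  sinh x * secular alpha n (2 * cosh x)
  = (1 + cabs alpha ^+ 2) * cosh (n%:R * x) * sinh x
    - (cabs alpha ^+ 2 - 1) * sinh (n%:R * x) * cosh x - 2 * re alpha * sinh x.
Proof.
case: n => // n _; rewrite /secular -pred_Sn.
have := sinh_cheb x n.+2; have := sinh_cheb x n.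
move: (cheb _ n) (cheb _ n.+2) => u v Eu Ev.
transitivity (sinh x * v - cabs alpha ^+ 2 * (sinh x * u) - 2 * re alpha * sinh x);
  first by ring.
rewrite -Eu -Ev.
have -> : n.+2%:R * x = n.+1%:R * x + x by rewrite -(natr1 n.+1); ring.
have -> : n%:R * x = n.+1%:R * x - x by rewrite -(natr1 n); ring.
by rewrite !sinhD sinhN coshN; ring.
Qed.

(** The reflection lambda -> 4 - lambda of the spectrum: it exchanges the two
    edges at the price of replacing alpha by (-1)^n alpha. *)
Lemma secular_opp alpha n (c : R) : (0 < n)%N ->
  secular alpha n (- c) = (-1) ^+ n * secular ((-1) ^+ n * alpha) n c.
Proof.
case: n => // n _; rewrite /secular -pred_Sn !cheb_opp cabs_sign Re_sign !exprS.
by rewrite -(signr_odd _ n); case: odd; ring.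
Qed.

Lemma sin_natpi j : sin (j%:R * pi) = 0 :> R.
Proof. by rewrite mulr_natl -[_ *+ _]add0r (alternatingn (@sinDpi R)) sin0 mulr0. Qed.

Lemma cos_natpi j : cos (j%:R * pi) = (-1) ^+ j :> R.
Proof. by rewrite mulr_natl -[_ *+ _]add0r (alternatingn (@cosDpi R)) cos0 mulr1. Qed.

Lemma node_range n j : (0 < j < n)%N -> 0 < (j%:R * pi / n%:R : R) < pi.
Proof.
move=> /andP[j0 jn]; have n0 : (0 : R) < n%:R by rewrite ltr0n; lia.
have p0 := pi_gt0 R.
rewrite ltr_pdivlMr // mul0r ltr_pdivrMr // mulr_gt0 ?ltr0n //=.
by rewrite mulrC ltr_pM2l // ltr_nat.
Qed.

(** At a node sin (n x) vanishes and cos (n x) is a sign. *)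
Lemma secular_node alpha n j : (0 < j < n)%N ->
  secular alpha n (2 - g (j%:R * pi / n%:R))
  = (-1) ^+ j * (1 + cabs alpha ^+ 2) - 2 * re alpha.
Proof.
move=> jn; have n0 : (0 < n)%N by lia.
have s0 : sin (j%:R * pi / n%:R) != 0 :> R.
  by rewrite gt_eqF // sin_gt0_pi // node_range.
rewrite gE subKr; apply: (mulfI s0); rewrite secular_cos //.
have -> : n%:R * (j%:R * pi / n%:R) = j%:R * pi :> R.
  by field; rewrite pnatr_eq0 -lt0n.
by rewrite sin_natpi cos_natpi; ring.
Qed.

(** The product of the two values is (2 Re alpha)^2 - (1 + |alpha|^2)^2. *)
Lemma secular_nodes_lt0 alpha n j :
  (0 < j)%N -> (j.+1 < n)%N -> 1 < cabs alpha ->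
  secular alpha n (2 - g (j%:R * pi / n%:R))
  * secular alpha n (2 - g (j.+1%:R * pi / n%:R)) < 0.
Proof.
move=> j0 jn a1; rewrite !secular_node; [|lia|lia].
have := Re_cabs_bound alpha.
move: (cabs alpha) (re alpha) a1 => a r a1 /andP[r1 r2].
have r3 : 0 <= (a - r) * (a + r) by rewrite mulr_ge0 //; lra.
have a3 : 0 < (a - 1) ^+ 2 * (a + 1) ^+ 2 by rewrite mulr_gt0 // exprn_gt0 //; lra.
rewrite [(-1) ^+ j.+1]exprS -signr_odd.
by case: odd; rewrite ?expr0 ?expr1; lra.
Qed.

(** Since u_k(2) = k, the value is (n + 1) - |alpha|^2 (n - 1) - 2 Re alpha; the
    worst case Re alpha = - |alpha| factors as
    (|alpha| + 1) (|alpha| + 1 - (|alpha| - 1) n). *)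
Lemma secular_2_lt0 alpha n : (0 < n)%N -> 1 < cabs alpha ->
  cabs alpha + 1 < (cabs alpha - 1) * n%:R -> secular alpha n 2 < 0.
Proof.
case: n => // n _ a1; rewrite /secular -pred_Sn !cheb_2 -!natr1.
have := Re_cabs_bound alpha.
move: (cabs alpha) (re alpha) a1 => a r a1 /andP[r1 r2].
move: (n%:R) => N H.
have : (a + 1) * (a + 1) < (a + 1) * ((a - 1) * (N + 1)) by rewrite ltr_pM2l //; lra.
by nra.
Qed.

Lemma cheb_ge1 (c : R) k : 2 <= c ->
  0 <= cheb c k /\ (c - 1) * cheb c k + 1 <= cheb c k.+1.
Proof.
move=> c2; elim: k => [|k [IH1 IH2]]; first by rewrite /= mulr0 add0r.
have u0 : 0 <= cheb c k.+1 by nra.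
by split=> //; rewrite chebSS; nra.
Qed.

(** For large c the values u_k grow at least by the factor c - 1, here at least
    |alpha| + 2, so u_{n+1} dominates |alpha|^2 u_{n-1}. *)
Lemma secular_gt0 alpha n (c : R) : (1 < n)%N -> cabs alpha + 3 <= c ->
  0 < secular alpha n c.
Proof.
case: n => [|[|n]] // _ ac; rewrite /secular -pred_Sn.
have := Re_cabs_bound alpha; have := cabs_ge0 alpha.
move: (cabs alpha) (re alpha) ac => a r ac a0 /andP[r1 r2].
have c2 : 2 <= c by lra.
have [t0 t1] := cheb_ge1 n c2.
have [_ u1] := cheb_ge1 n.+1 c2; have [_ u3] := cheb_ge1 n.+2 c2.
have u0 : 1 <= cheb c n.+1 by nra.
move: u0 u1 u3; move: (cheb c n.+1) (cheb c n.+2) (cheb c n.+3) => u v w u0 u1 u3.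
have cu : 0 <= (c - (a + 3)) * u by rewrite mulr_ge0; lra.
have v1 : (a + 2) * u + 1 <= v by lra.
have au : 0 <= a * (u - 1) by rewrite mulr_ge0 //; lra.
have cv : 0 <= (c - (a + 3)) * v by rewrite mulr_ge0; lra.
have w1 : (a + 2) * v + 1 <= w by lra.
have : (a + 2) * ((a + 2) * u + 1) <= (a + 2) * v by rewrite ler_pM2l //; lra.
by lra.
Qed.

(** Expressing sinh (n x) and cosh (n x) through t = tanh (n x / 2) makes the
    secular equation linear in tanh x. *)
Lemma edge_solP alpha n m x : (0 < n)%N -> 1 < cabs alpha -> 0 < x ->
  edge_sol alpha n ((-1) ^+ m) x
  <-> secular ((-1) ^+ m * alpha) n (2 * cosh x) = 0.
Proof.
move=> n0 a1 x0.
have -> : edge_sol alpha n ((-1) ^+ m) x <->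
    tanh x = edge_arg alpha n ((-1) ^+ m) x.
  split; first by case=> _ ? ?; apply/arctanhP.
  by move/arctanhP => [].
have sx0 : 0 < sinh x by rewrite sinh_gt0.
have -> : secular ((-1) ^+ m * alpha) n (2 * cosh x) = 0 <->
   sinh x * secular ((-1) ^+ m * alpha) n (2 * cosh x) = 0.
  split=> [->|/eqP]; first by rewrite mulr0.
  by rewrite mulf_eq0 gt_eqF //= => /eqP.
rewrite secular_cosh // cabs_sign /edge_arg cabs_add_sign.
have -> : alpha - (-1) ^+ m = alpha + (-1) ^+ m.+1 by rewrite exprS mulN1r.
rewrite cabs_add_sign [(-1) ^+ m.+1]exprS mulN1r mulNr raddfN /=.
have := Re_cabs_bound ((-1) ^+ m * alpha); rewrite cabs_sign.
move: (re _) (cabs alpha) a1 => r a a1 /andP[r1 r2].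
have -> : n%:R * x = n%:R * x / 2 + n%:R * x / 2 by field.
rewrite sinhD coshD /tanh.
have := cosh2sinh2 (n%:R * x / 2); have := cosh_gt0 (n%:R * x / 2).
have : 0 < sinh (n%:R * x / 2) by rewrite sinh_gt0 divr_gt0 // mulr_gt0 ?ltr0n.
have -> : (n%:R * x / 2 + n%:R * x / 2) / 2 = n%:R * x / 2 by field.
move: (sinh (n%:R * x / 2)) (cosh (n%:R * x / 2)) (cosh_gt0 x) sx0 => sh ch.
move: (sinh x) (cosh x) => sx cx cx0 sx0 sh0 ch0 cs.
have P0 : 0 < a ^+ 2 + 1 + 2 * r by nra.
have M0 : 0 < a ^+ 2 + 1 - 2 * r by nra.
have D0 : 0 < (a ^+ 2 + 1 + 2 * r) * sh ^+ 2 + (a ^+ 2 + 1 - 2 * r) * ch ^+ 2.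
  by rewrite addr_gt0 // mulr_gt0 // exprn_gt0.
have -> : 2 * (a ^+ 2 - 1) * (sh / ch) /
   ((a ^+ 2 + 1 + 2 * r) * (sh / ch) ^+ 2 + (a ^+ 2 + 1 + 2 * - r)) =
   2 * (a ^+ 2 - 1) * sh * ch
   / ((a ^+ 2 + 1 + 2 * r) * sh ^+ 2 + (a ^+ 2 + 1 - 2 * r) * ch ^+ 2).
  by field; rewrite !gt_eqF.
set D := (X in _ = _ / X) in D0 *; set N := 2 * _ * _ * _.
have -> : (1 + a ^+ 2) * (ch * ch + sh * sh) * sx
   - (a ^+ 2 - 1) * (sh * ch + ch * sh) * cx - 2 * r * sx = sx * D - N * cx.
  have -> : 2 * r * sx = 2 * r * sx * (ch ^+ 2 - sh ^+ 2) by rewrite cs mulr1.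
  by rewrite /D /N; ring.
have [cx_neq0 D_neq0] : cx != 0 /\ D != 0 by rewrite !gt_eqF.
split=> [/eqP|/subr0_eq E].
  by rewrite eqr_div // => /eqP ->; rewrite subrr.
by apply/eqP; rewrite eqr_div // E.
Qed.

Lemma g_invP (l : R) : 0 < l < 4 -> 0 < g_inv l < pi /\ g (g_inv l) = l.
Proof.
move=> /andP[l0 l4]; pose x := acos (1 - l / 2).
have gx : g x = l by rewrite gE acosK; [field | rewrite in_itv /=; lra].
have x0 : 0 < x by apply: acos_gt0; lra.
have xpi : x < pi by apply: acos_ltpi; lra.
suff -> : g_inv l = x by rewrite x0 xpi.
rewrite -gx /g_inv pinvKV //.
  move=> y z; rewrite !inE /= => y_in z_in; rewrite !gE => E.
  by apply: cos_inj => //; lra.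
by rewrite inE /= in_itv /= !ltW.
Qed.

Lemma ltr_g : {in `[0, pi] &, {mono @g R : x y / x < y}}.
Proof. by move=> x y x0 y0; rewrite !gE ltrD2l ltrN2 ltr_pM2l // ltr_cos. Qed.

(** Let m = j + 1 and y = (m pi - n x) / 2.  Between two nodes 0 < y < pi / 2, so
    t = tan y is positive and y = atan t.  The secular equation, quadratic in
    tan (n x / 2), becomes a monic quadratic equation for t if m is even and for
    1 / t if m is odd.  Its roots have the product - l^2 < 0, so t, or 1 / t, is
    the root with the positive square root. *)
Lemma secular_eta alpha n j (x : R) : (0 < n)%N -> 1 < cabs alpha ->
  0 < x < pi -> j%:R * pi < n%:R * x < j.+1%:R * pi ->
  secular alpha n (2 * cos x) = 0 ->
  n%:R * x = j.+1%:R * pi + eta_fun alpha j.+1%:Z x.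
Proof.
move=> n0 a1 /andP[x0 xpi] /andP[x1 x2] sec0.
have s0 : 0 < sin x by rewrite sin_gt0_pi ?x0.
rewrite /eta_fun gt_eqF // lt_eqF //.
pose y := (j.+1%:R * pi - n%:R * x) / 2.
have y0 : 0 < y by rewrite /y; lra.
have y1 : y < pi / 2.
  have : j.+1%:R * pi = j%:R * pi + pi :> R by rewrite -natr1 mulrDl mul1r.
  by rewrite /y; lra.
have c0 : 0 < cos y.
  by apply: cos_gt0_pihalf; rewrite y1 andbT; have := pi_gt0 R; lra.
have sy0 : 0 < sin y by apply: sin_gt0_pihalf; rewrite y0 y1.
suff E : tan y = ((-1) ^ (j.+1%:Z + 1) * kcoef alpha * cot x +
    Num.sqrt (kcoef alpha ^+ 2 * cot x ^+ 2 + lcoef alpha ^+ 2))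
    ^ ((-1 : int) ^ j.+1%:Z).
  rewrite /eta_interior -E tanK ?in_itv /=; first by rewrite /y; field.
  by rewrite y1 andbT; have := pi_gt0 R; lra.
set t := tan y.
have t0 : 0 < t by rewrite divr_gt0.
have a0 := Re_cabs_bound alpha.
have quad : (1 + cabs alpha ^+ 2 + (-1) ^+ j.+1 * (2 * re alpha)) * t ^+ 2
    + 2 * (1 - cabs alpha ^+ 2) * cot x * t
    - (1 + cabs alpha ^+ 2 - (-1) ^+ j.+1 * (2 * re alpha)) = 0.
  have := secular_cos alpha x n0; rewrite sec0 mulr0.
  have -> : n%:R * x = j.+1%:R * pi - y *+ 2 by rewrite /y mulr2n; field.
  rewrite sinB cosB sin_natpi cos_natpi sin_mulr2n cos_mulr2n.
  rewrite !mul0r sub0r addr0.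
  have := cos2Dsin2 y; rewrite /t /tan /cot; move: (sqrr_sign R j.+1).
  move: ((-1) ^+ j.+1) (cos y) (sin y) (cos x) (sin x) c0 s0.
  move: (cabs alpha) (re alpha).
  move=> a r e cy sy cx sx cy0 sx0 e2 cs E.
  (* The quadratic polynomial in tan y is the secular equation divided by this
     factor. *)
  apply: (mulfI (_ : - (e * cy ^+ 2 * sx) != 0)).
    rewrite oppr_eq0 !mulf_neq0 ?expf_neq0 ?(gt_eqF cy0) ?(gt_eqF sx0) //.
    by rewrite -sqrf_eq0 e2 oner_eq0.
  have r_sx : 2 * r * sx = 2 * r * sx * e ^+ 2 * (cy ^+ 2 + sy ^+ 2).
    by rewrite cs e2 !mulr1.
  have cos2y : cy ^+ 2 *+ 2 - 1 = cy ^+ 2 - sy ^+ 2 by rewrite -cs; ring.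
  rewrite mulr0 E r_sx cos2y; field.
  by rewrite !gt_eqF.
have -> : (-1 : int) ^ j.+1%:Z = (-1) ^+ j.+1 by [].
have -> : (-1 : R) ^ (j.+1%:Z + 1) = - (-1) ^+ j.+1.
  by rewrite -PoszD addn1 -exprnP exprS mulN1r.
have [-> ->] :
  kcoef alpha = (1 - cabs alpha ^+ 2) / (cabs alpha ^+ 2 + 1 + 2 * re alpha) /\
  lcoef alpha ^+ 2 = (cabs alpha ^+ 2 + 1 - 2 * re alpha)
                     / (cabs alpha ^+ 2 + 1 + 2 * re alpha).
  have := cabs_add_sign alpha 0; have := cabs_add_sign alpha 1.
  rewrite expr0 expr1 mul1r mulN1r raddfN /= => E1 E0.
  have E1' : cabs (1 - alpha) = cabs (alpha - 1).
    by rewrite -[RHS](cabs_sign _ 1) expr1 mulN1r opprB.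
  rewrite /kcoef /lcoef expr_div_n E1' E1 [1 + alpha]addrC E0; split=> //.
  by congr (_ / _); ring.
have sqrt_root (k l w : R) : w ^+ 2 - 2 * k * w - l = 0 -> 0 < w -> 0 < l ->
   w = k + Num.sqrt (k ^+ 2 + l).
  move=> wE w0 l0; suff -> : k ^+ 2 + l = (w - k) ^+ 2.
    rewrite sqrtr_sqr ger0_norm; [by ring | nra].
  by rewrite -[LHS]addr0 -wE; ring.
move: quad a0 a1; move: (cabs alpha) (re alpha) (cot x) => a r c quad /andP[r1 r2] a1.
have P0 : 0 < a ^+ 2 + 1 + 2 * r by nra.
have M0 : 0 < a ^+ 2 + 1 - 2 * r by nra.
rewrite -exprMn; move: quad; rewrite -signr_odd -[(-1 : int) ^+ _]signr_odd.
set P := a ^+ 2 + 1 + 2 * r in P0 *; set M := a ^+ 2 + 1 - 2 * r in M0 *.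
have PM0 : 0 < M / P by rewrite divr_gt0.
case: odd; rewrite ?expr0 ?expr1 => quad.
  rewrite exprN1 -[LHS]invrK; congr _^-1.
  rewrite opprK mul1r; apply: sqrt_root; rewrite ?invr_gt0 //.
  apply: (mulfI (_ : - (t ^+ 2 * P) != 0)).
    by rewrite oppr_eq0 mulf_neq0 ?expf_neq0 ?gt_eqF.
  rewrite mulr0 -[RHS]quad /P /M; field.
  by rewrite !gt_eqF.
rewrite expr1z mulN1r mulNr -[(_ * _) ^+ 2]sqrrN; apply: sqrt_root => //.
apply: (mulfI (_ : P != 0)); first by rewrite gt_eqF.
rewrite mulr0 -[RHS]quad /P /M; field.
by rewrite gt_eqF.
Qed.

End Evaluation.

(** * Location of the eigenvalues *)

Section Localisation.
Context {R : realType}.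
Implicit Types (alpha : R[i]).

(** With L = ln |alpha|, the bounds ln L <= L - 1 and ln (|alpha| + 1) >= L show
    that the numerator of [N2] is at least 16 L + 4; and
    L (|alpha| + 1) <= (L + 2) (|alpha| - 1), since L <= |alpha| - 1. *)
Lemma N2_bound alpha n : 1 < cabs alpha -> N2 alpha <= n%:R ->
  cabs alpha + 1 < (cabs alpha - 1) * n%:R.
Proof.
rewrite /N2; move: (cabs alpha) n%:R => a N a1.
have L0 : 0 < ln a by rewrite ln_gt0.
rewrite ler_pdivrMr //.
have L1 : ln a <= a - 1.
  by rewrite -[X in ln X](subrKC 1 a) le_ln1Dx //; lra.
have LL : ln (ln a) <= ln a - 1.
  by rewrite -[X in ln X](subrKC 1 (ln a)) le_ln1Dx //; lra.
have La : ln a <= ln (a + 1) by rewrite ler_ln ?posrE; lra.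
move: L0 L1 LL La; move: (ln a) (ln (ln a)) (ln (a + 1)) => L LL LA L0 L1 L2 L3 H.
rewrite -(ltr_pM2l L0).
have : (a - 1) * (16 * L + 4) <= (a - 1) * (N * L) by rewrite ler_pM2l; lra.
have : 0 < (a - 1) * L by rewrite mulr_gt0 //; lra.
lra.
Qed.

Lemma node_itv n j : (0 < j < n)%N -> (j%:R * pi / n%:R : R) \in `[0, pi].
Proof.
by move=> jn; have /andP[x0 x1] := @node_range R n j jn; rewrite in_itv /= !ltW.
Qed.

Lemma g_node_range n j : (0 < j < n)%N -> 0 < g (j%:R * pi / n%:R : R) < 4.
Proof.
move=> jn; have x_in := node_itv jn; have /andP[x0 x1] := @node_range R n j jn.
have g0 : g 0 = 0 :> R by rewrite gE cos0; ring.
have gpi : g pi = 4 :> R by rewrite gE cospi; ring.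
have pi0 := @pi_ge0 R.
by rewrite -[X in X < _]g0 -gpi !ltr_g // ?x0 // in_itv /= lexx ?pi0.
Qed.

(** One zero for each of n disjoint intervals: below 0, between consecutive
    nodes, and above 4.  The bound k < n is put under the existential quantifier
    so that a choice function on all of nat can be extracted. *)
Lemma secular_roots alpha n : (3 <= n)%N -> 1 < cabs alpha ->
  cabs alpha + 1 < (cabs alpha - 1) * n%:R ->
  forall k, exists x, (k < n)%N ->
    [/\ secular alpha n (2 - x) = 0, k = 0%N -> x < 0, k.+1 = n -> 4 < x
      & (0 < k)%N -> (k.+1 < n)%N ->
        g (k%:R * pi / n%:R) < x < g (k.+1%:R * pi / n%:R)].
Proof.
move=> n3 a1 an k; have n0 : (0 < n)%N by lia.
have cabs_s := cabs_sign alpha n.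
case: (ltnP k n) => kn; last by exists 0.
case: (posnP k) => [k0|k0].
  have [||x /andP[_ x0] xroot] :=
    @secular_root_between _ alpha n (- (cabs alpha + 1)) 0.
  - by lra.
  - rewrite subr0 pmulr_rlt0 ?secular_2_lt0 //.
    by apply: secular_gt0; [lia|lra].
  by exists x => _; split=> // *; exfalso; lia.
case: (ltnP k.+1 n) => kn1.
  have node_le : g (k%:R * pi / n%:R : R) <= g (k.+1%:R * pi / n%:R).
    rewrite ltW // ltr_g ?node_itv //; [|lia..].
    by rewrite ltr_pM2r ?invr_gt0 ?ltr0n // ltr_pM2r ?pi_gt0 // ltr_nat.
  have [x xk xroot] :=
    secular_root_between node_le (secular_nodes_lt0 k0 kn1 a1).
  by exists x => _; split=> // *; exfalso; lia.
have [||x /andP[x4 _] xroot] :=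
  @secular_root_between _ alpha n 4 (cabs alpha + 5).
- by lra.
- have -> : 2 - 4 = - 2 :> R by ring.
  have -> : 2 - (cabs alpha + 5) = - (cabs alpha + 3) :> R by ring.
  rewrite !secular_opp // mulrACA -expr2 sqrr_sign mul1r nmulr_rlt0.
    by rewrite secular_gt0 // ?cabs_s //; lia.
  by rewrite secular_2_lt0 // cabs_s.
by exists x => _; split=> // *; exfalso; lia.
Qed.

Lemma lambda_location alpha n : (3 <= n)%N -> 1 < cabs alpha ->
  cabs alpha + 1 < (cabs alpha - 1) * n%:R ->
  [/\ forall k, (k < n)%N -> secular alpha n (2 - lambda alpha n k.+1) = 0,
      lambda alpha n 1 < 0, 4 < lambda alpha n n
    & forall k, (0 < k)%N -> (k.+1 < n)%N ->
      g (k%:R * pi / n%:R) < lambda alpha n k.+1 < g (k.+1%:R * pi / n%:R)].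
Proof.
move=> n3 a1 an.
have [mu muP] := choice (secular_roots n3 a1 an).
have mu_lt k : (k.+1 < n)%N -> mu k < mu k.+1.
  move=> kn; have [_ k0 _ k_mid] := muP _ (ltnW kn).
  have [_ _ kn1 k1_mid] := muP _ kn.
  have : mu k < g (k.+1%:R * pi / n%:R).
    case: (posnP k) => [k_eq0|k_gt0]; last by have /andP[] := k_mid k_gt0 kn.
    have /andP[+ _] := @g_node_range n k.+1 kn; exact/lt_trans/k0.
  move=> /lt_trans -> //.
  case: (ltnP k.+2 n) => kn2; first by have /andP[] := k1_mid isT kn2.
  have /andP[_ /lt_trans -> //] := @g_node_range n k.+1 kn.
  by apply: kn1; lia.
have lambdaE k : (k < n)%N -> lambda alpha n k.+1 = mu k.
  by apply: lambda_eq_roots => // i /muP[].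
split=> [k kn|||k k0 kn].
- by rewrite lambdaE //; have [] := muP _ kn.
- have n0 : (0 < n)%N by lia.
  by rewrite lambdaE //; have [_ -> //] := muP _ n0.
- have nn : (n.-1 < n)%N by lia.
  have nE : n = n.-1.+1 by lia.
  rewrite [X in lambda _ _ X]nE lambdaE //; have [_ _ + _] := muP _ nn.
  by apply.
- by rewrite lambdaE ?(ltnW kn) //; have [_ _ _ ->] := muP _ (ltnW kn).
Qed.

End Localisation.

Theorem theorem5 (R : realType) (alpha : R[i]) (n : nat) :
  (3 <= n)%N -> 1 < cabs alpha -> N2 alpha <= n%:R ->
  [/\ exists theta : R, unique (edge_sol alpha n 1) theta /\
        lambda alpha n 1 = g_minus theta,
      exists theta : R, unique (edge_sol alpha n ((-1) ^+ n)) theta /\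
        lambda alpha n n = g_plus theta
    & forall j : nat, (2 <= j <= n.-1)%N ->
        let theta := g_inv (lambda alpha n j) in
        [/\ 0 < lambda alpha n j < 4,
            lambda alpha n j = g theta
          & theta = (j%:R * pi + eta_fun alpha j%:Z theta) / n%:R]].
Proof.
move=> n3 a1 /(N2_bound a1) an; have n0 : (0 < n)%N by lia.
have [root_lambda lambda1_lt0 lambdan_gt4 lambda_mid] := lambda_location n3 a1 an.
have mid_range k : (0 < k)%N -> (k.+1 < n)%N -> 0 < lambda alpha n k.+1 < 4.
  move=> k0 kn; have /andP[l1 l2] := lambda_mid k k0 kn.
  have /andP[g0 _] := @g_node_range R n k ltac:(lia).
  have /andP[_ g4] := @g_node_range R n k.+1 ltac:(lia).
  by rewrite (lt_trans g0 l1) (lt_trans l2 g4).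
(* An eigenvalue outside [0, 4] is the first or the last one. *)
have outer x : secular alpha n (2 - x) = 0 ->
    (x < 0 -> x = lambda alpha n 1) /\ (4 < x -> x = lambda alpha n n).
  move=> /(secular_root_lambda n3)[k kn ->].
  case: (posnP k) => [->|k0]; first by split=> // ?; exfalso; lra.
  case: (ltnP k.+1 n) => kn1.
    by have /andP[? ?] := mid_range k k0 kn1; split=> ?; exfalso; lra.
  have -> : k.+1 = n by lia.
  by split=> // ?; exfalso; lra.
split.
- have [|x x0 xE] := @cosh_surj R (1 - lambda alpha n 1 / 2); first lra.
  have lE : lambda alpha n 1 = g_minus x by rewrite g_minusE xE; field.
  have edge y : 0 < y -> edge_sol alpha n 1 y <-> secular alpha n (2 - g_minus y) = 0.
    move=> y0; have := @edge_solP _ alpha n 0 y n0 a1 y0.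
    by rewrite expr0 mul1r g_minusE subKr.
  exists x; split=> //; split=> [|y y_sol].
    by apply/edge => //; rewrite -lE root_lambda.
  have y0 : 0 < y by case: y_sol.
  have [+ _] := outer _ ((edge y y0).1 y_sol); rewrite lE !g_minusE.
  have := cosh_gt1 y0 => c1 E; apply: cosh_inj => //.
  have := E ltac:(lra); lra.
- have [|x x0 xE] := @cosh_surj R (lambda alpha n n / 2 - 1); first lra.
  have lE : lambda alpha n n = g_plus x by rewrite g_plusE xE; field.
  have edge y : 0 < y -> edge_sol alpha n ((-1) ^+ n) y <->
      secular alpha n (2 - g_plus y) = 0.
    move=> y0; apply: (iff_trans (@edge_solP _ alpha n n y n0 a1 y0)).
    rewrite g_plusE; have -> : 2 - (2 + 2 * cosh y) = - (2 * cosh y) by ring.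
    rewrite secular_opp //; split=> [->|/eqP]; first by rewrite mulr0.
    by rewrite mulf_eq0 signr_eq0 => /eqP.
  exists x; split=> //; split=> [|y y_sol].
    apply/edge => //; rewrite -lE.
    by have := root_lambda n.-1; rewrite prednK //; apply.
  have y0 : 0 < y by case: y_sol.
  have [_ +] := outer _ ((edge y y0).1 y_sol); rewrite lE !g_plusE.
  have := cosh_gt1 y0 => c1 E; apply: cosh_inj => //.
  have := E ltac:(lra); lra.
- case=> // k k_bounds theta; have k0 : (0 < k)%N by lia.
  have kn : (k.+1 < n)%N by lia.
  have l_range := mid_range k k0 kn.
  have [theta_range gtheta] := g_invP l_range; rewrite -/theta in theta_range gtheta.
  have /andP[g1 g2] := lambda_mid k k0 kn.
  have nR0 : (0 : R) < n%:R by rewrite ltr0n.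
  have theta_in : theta \in `[0, pi].
    by case/andP: theta_range => t0 t1; rewrite in_itv /= !ltW.
  split=> //.
  have kn0 : (0 < k < n)%N by lia.
  have n_theta : k%:R * pi < n%:R * theta < k.+1%:R * pi.
    move: g1 g2; rewrite -gtheta !ltr_g ?node_itv //.
    by rewrite ltr_pdivrMr // ltr_pdivlMr // [theta * _]mulrC => -> ->.
  rewrite -(secular_eta n0 a1 theta_range n_theta).
    by rewrite [_ * theta]mulrC mulfK // gt_eqF.
  by have := root_lambda k (ltnW kn); rewrite -gtheta gE subKr.
Qed.
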